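(* Let $\alpha,c,d,\tau>0$, $N\in\mathbb{N}$, $h=\frac1{N+1}$, and let $L_h$ be the $N\times N$ tridiagonal Dirichlet matrix with entries $(L_h)_{jj}=\frac{2d}{h^2}$, $(L_h)_{j,j\pm1}=-\frac{d}{h^2}$, and all other entries zero. Suppose $\tilde U_h^n,V_h^n\in\mathbb{R}^N$ satisfy the implicit scheme, for $n\ge1$, $$\frac{\tilde U_h^n-\tilde U_h^{n-1}}{\tau}-\alpha(\sqrt c\,V_h^n-c\,\tilde U_h^n)+L_h\tilde U_h^n=0,\qquad \frac{V_h^n-V_h^{n-1}}{\tau}+\alpha(V_h^n-\sqrt c\,\tilde U_h^n)=0 .$$ Then the scheme is strongly stable: for every $n\ge1$, $$\|\tilde U_h^n\|^2+\|V_h^n\|^2\le\|\tilde U_h^{n-1}\|^2+\|V_h^{n-1}\|^2 .$$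
   Context: $\|\cdot\|$ is the Euclidean norm on $\mathbb{R}^N$. The scheme is the symmetrized and rescaled form, with $\tilde U_h^n=\sqrt c\,U_h^n$ and zero source, of the implicit finite difference discretization on $\Omega=(0,1)$ (with homogeneous Dirichlet conditions) of the system $u_t+v_t-d\,u_{xx}=0$, $v_t+\alpha(v-cu)=0$; thus the inequality is equivalent to $c\|U_h^n\|^2+\|V_h^n\|^2\le c\|U_h^{n-1}\|^2+\|V_h^{n-1}\|^2$. *)

(* Defs.v *)
From mathcomp Require Import all_boot all_order all_algebra reals.

Set Implicit Arguments.
Unset Strict Implicit.
Unset Printing Implicit Defensive.

Import Order.TTheory GRing.Theory Num.Theory.
Local Open Scope ring_scope.

(* The norm that MathComp-Analysis puts on matrices is the sup norm, hence a
   separate definition of the Euclidean one. *)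
Definition enorm (R : realType) (N : nat) (x : 'cV[R]_N) : R :=
  Num.sqrt (\sum_(i < N) x i 0 ^+ 2).

Definition dirichlet_mx (R : realType) (N : nat) (d h : R) : 'M[R]_N :=
  \matrix_(i < N, j < N)
    if i == j :> nat then 2 * d / h ^+ 2
    else if (j == i.+1 :> nat) || (i == j.+1 :> nat) then - (d / h ^+ 2)
    else 0.

(* Main.v *)
Require Import Defs.
From mathcomp Require Import all_boot all_order all_algebra reals.
From mathcomp Require Import ring.

(** The estimate is the energy identity of backward Euler.  Testing the first
    equation with [U n], the second with [V n] and adding, the two coupling
    terms combine into [- alpha * |sqrt c * U n - V n|^2]: symmetrizing the
    system with the weight [sqrt c] makes the exchange matrix
    [[c, - sqrt c], [- sqrt c, 1]] positive semidefinite.  The implicit time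
    difference satisfies [2 x (x - x') >= x^2 - x'^2], so the energy grows by
    at most [- 2 tau (U n, L_h (U n))].  This is nonpositive because [L_h] is
    positive semidefinite ([dirichlet_mx_psd]): summation by parts turns its
    quadratic form into [d / h^2] times the sum of the squared increments of
    the vector extended by zero at the two boundary nodes. *)

Set Implicit Arguments.
Unset Strict Implicit.
Unset Printing Implicit Defensive.

Import Order.TTheory GRing.Theory Num.Theory.
Local Open Scope ring_scope.

Lemma enorm_sqr (R : realType) (N : nat) (x : 'cV[R]_N) :
  enorm x ^+ 2 = \sum_(i < N) x i 0 ^+ 2.
Proof. by rewrite sqr_sqrtr // sumr_ge0 // => i _; rewrite sqr_ge0. Qed.

(** Nodes are numbered [0, ..., N + 1], both ends carrying the Dirichlet value
    [0], so row [i] of the vector sits at node [i + 1].  Being written as a sum,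
    the extension can be compared term by term with a matrix-vector product. *)
Definition zero_ext (R : pzRingType) (N : nat) (x : 'cV[R]_N) (m : nat) : R :=
  \sum_(j < N) x j 0 *+ (m == j.+1).

Lemma zero_ext0 (R : pzRingType) (N : nat) (x : 'cV[R]_N) : zero_ext x 0 = 0.
Proof. by rewrite /zero_ext big1. Qed.

Lemma zero_ext_max (R : pzRingType) (N : nat) (x : 'cV[R]_N) :
  zero_ext x N.+1 = 0.
Proof.
by rewrite /zero_ext big1 // => j _; rewrite eqSS gtn_eqF.
Qed.

Lemma zero_extS (R : pzRingType) (N : nat) (x : 'cV[R]_N) (i : 'I_N) :
  zero_ext x i.+1 = x i 0.
Proof.
rewrite /zero_ext (bigD1 i) //= eqxx big1 ?addr0 // => j nji.
by rewrite eqSS eq_sym val_eqE (negPf nji).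
Qed.

(** With the zero extension, boundary rows need no separate treatment: every
    row is a multiple of the centered second difference. *)
Lemma dirichlet_mxE (R : realType) (N : nat) (d h : R) (x : 'cV[R]_N)
    (i : 'I_N) :
  (dirichlet_mx N d h *m x) i 0 =
  d / h ^+ 2 *
  (2 * zero_ext x i.+1 - zero_ext x i - zero_ext x i.+2).
Proof.
rewrite mxE /zero_ext mulr_sumr -!sumrB mulr_sumr.
apply: eq_bigr => j _; rewrite mxE !eqSS [i.+1 == j]eq_sym.
have [->|nij] := eqVneq (i : nat) j.
  by rewrite [j == j.+1 :> nat]ltn_eqF //= !mulr0n mulr1n; ring.
have [->|_] := eqVneq (j : nat) i.+1.
  by rewrite [i == i.+2 :> nat]ltn_eqF //= !mulr0n mulr1n; ring.
by case: (_ == _); rewrite /= ?mulr0n ?mulr1n; ring.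
Qed.

(** The right end value [f N.+1] stays free, since the induction on [N] moves that
    end; when it is [0], the term [f N ^+ 2] is the last squared increment. *)
Lemma sum_by_parts_second_diff (R : comPzRingType) (f : nat -> R) (N : nat) :
  f 0 = 0 ->
  \sum_(i < N) f i.+1 * (2 * f i.+1 - f i - f i.+2) =
  \sum_(i < N) (f i.+1 - f i) ^+ 2 + f N ^+ 2 - f N * f N.+1.
Proof.
move=> f0; elim: N => [|N IHN]; first by rewrite !big_ord0 f0; ring.
by rewrite !big_ord_recr /= IHN; ring.
Qed.

Lemma dirichlet_mx_psd (R : realType) (N : nat) (d h : R) (x : 'cV[R]_N) :
  0 <= d -> 0 <= \sum_(i < N) x i 0 * (dirichlet_mx N d h *m x) i 0.
Proof.
move=> d_ge0.
under eq_bigr => i _ do rewrite dirichlet_mxE -zero_extS mulrCA.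
rewrite -mulr_sumr mulr_ge0 ?divr_ge0 ?sqr_ge0 //.
rewrite sum_by_parts_second_diff ?zero_ext0 // zero_ext_max mulr0 subr0.
by rewrite addr_ge0 ?sqr_ge0 // sumr_ge0 // => i _; rewrite sqr_ge0.
Qed.

(** The energy estimate at a single grid point, [w] being the value there of the
    diffusion term and [s] the square root of the coefficient [c].  The defect
    of the inequality is
    [(u - u')^2 + (v - v')^2 + 2 tau alpha (s u - v)^2]. *)
Lemma pointwise_energy (R : realFieldType) (alpha s tau u u' v v' w : R) :
  0 <= alpha -> 0 < tau ->
  tau^-1 * (u - u') - alpha * (s * v - s ^+ 2 * u) + w = 0 ->
  tau^-1 * (v - v') + alpha * (v - s * u) = 0 ->
  u ^+ 2 + v ^+ 2 <= u' ^+ 2 + v' ^+ 2 - 2 * tau * (u * w).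
Proof.
move=> alpha_ge0 tau_gt0 equ eqv.
have tau_neq0 : tau != 0 by rewrite gt_eqF.
have -> : u' = u + tau * (w - alpha * (s * v - s ^+ 2 * u)).
  rewrite -[LHS]addr0 -(mulr0 tau) -equ; field; exact: tau_neq0.
have -> : v' = v + tau * (alpha * (v - s * u)).
  rewrite -[LHS]addr0 -(mulr0 tau) -eqv; field; exact: tau_neq0.
rewrite -subr_ge0.
set defect := (X in 0 <= X).
have -> : defect = (tau * (w - alpha * (s * v - s ^+ 2 * u))) ^+ 2
    + (tau * (alpha * (v - s * u))) ^+ 2
    + 2 * (tau * alpha) * (s * u - v) ^+ 2 by rewrite /defect; ring.
by rewrite !addr_ge0 ?sqr_ge0 // mulr_ge0 ?sqr_ge0 // !mulr_ge0 // ltW.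
Qed.

Theorem corollary2 (R : realType) (alpha c d tau : R) (N : nat) (h : R)
    (U V : nat -> 'cV[R]_N)
    (alpha_gt0 : 0 < alpha) (c_gt0 : 0 < c) (d_gt0 : 0 < d) (tau_gt0 : 0 < tau)
    (h_def : h = 1 / (N%:R + 1))
    (schemeU : forall n : nat, (1 <= n)%N ->
      tau^-1 *: (U n - U n.-1)
        - alpha *: (Num.sqrt c *: V n - c *: U n)
        + dirichlet_mx N d h *m U n = 0)
    (schemeV : forall n : nat, (1 <= n)%N ->
      tau^-1 *: (V n - V n.-1) + alpha *: (V n - Num.sqrt c *: U n) = 0) :
  forall n : nat, (1 <= n)%N ->
    enorm (U n) ^+ 2 + enorm (V n) ^+ 2
      <= enorm (U n.-1) ^+ 2 + enorm (V n.-1) ^+ 2.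
Proof.
move=> n n_gt0; rewrite !enorm_sqr -!big_split /=.
set W := dirichlet_mx N d h *m U n.
apply: (@le_trans _ _ (\sum_(i < N)
    (U n.-1 i 0 ^+ 2 + V n.-1 i 0 ^+ 2 - 2 * tau * (U n i 0 * W i 0)))).
  apply: ler_sum => i _.
  apply: (@pointwise_energy _ alpha (Num.sqrt c)) => //; first exact: ltW.
    have /matrixP/(_ i 0) := schemeU n n_gt0.
    by rewrite -/W sqr_sqrtr ?(ltW c_gt0) //; move: W => W; rewrite !mxE.
  by have /matrixP/(_ i 0) := schemeV n n_gt0; rewrite !mxE.
rewrite sumrB -mulr_sumr gerBl.
by rewrite mulr_ge0 ?dirichlet_mx_psd ?(ltW d_gt0) // mulr_ge0 ?ltW.
Qed.
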